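(* Let $r\ge2$. The set of all infinite type maps has full Lebesgue measure in $\mathrm{ITM}(r)\setminus\mathcal S(r)$, where $\mathcal S(r)$ is the set of stable maps; that is, the set of maps in $\mathrm{ITM}(r)\setminus\mathcal S(r)$ that are not of infinite type has Lebesgue measure zero.
   Context: Let $I=[0,1)$. An interval translation mapping (ITM) on $r$ intervals is a map $T:I\to I$ given by parameters $0=\beta_0<\beta_1<\dots<\beta_{r-1}<\beta_r=1$ and $\gamma_1,\dots,\gamma_r\in\mathbb R$ with $\gamma_i\in[-\beta_{i-1},1-\beta_i]$, via $T(x)=x+\gamma_i$ for $x\in I_i=[\beta_{i-1},\beta_i)$. $\mathrm{ITM}(r)\subset\mathbb R^{2r-1}$ is the set of parameter vectors $(\gamma_1,\dots,\gamma_r,\beta_1,\dots,\beta_{r-1})$, with the subspace topology and Lebesgue measure of $\mathbb R^{2r-1}$; maps are identified with their parameters. $X(T)=\bigcap_{n\ge0}T^n(I)$. $T$ is of finite type if $T^{n+1}(I)=T^n(I)$ for some $n$, and of infinite type otherwise. $T$ is stable if there is a neighbourhood $\mathcal U$ of $T$ in $\mathrm{ITM}(r)$ such that: (1) $\tilde T\mapsto\overline{X(\tilde T)}$ is continuous on $\mathcal U$ in the Hausdorff topology on compact sets, and $\overline{X(\tilde T)}$ is homeomorphic to $\overline{X(T)}$ for each $\tilde T\in\mathcal U$; (2) the number of discontinuities $\beta_1,\dots,\beta_{r-1}$ of $\tilde T$ lying in $I\setminus\overline{X(\tilde T)}$ is constant for $\tilde T\in\mathcal U$. *)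

(* Defs.v *)
From HB Require Import structures.
From mathcomp Require Import all_boot all_order all_algebra.
From mathcomp Require Import all_classical all_reals all_analysis.

Set Implicit Arguments.
Unset Strict Implicit.
Unset Printing Implicit Defensive.

Import Order.TTheory GRing.Theory Num.Theory.
Import numFieldNormedType.Exports.

Local Open Scope classical_set_scope.
Local Open Scope ring_scope.

(* The library has Lebesgue measure only on the line.  On R^n we use the outer
   measure obtained from countable covers by half-open boxes: this is the value
   of the (complete) Lebesgue measure on Lebesgue measurable sets, and sets of
   outer measure 0 are measurable. *)
Definition box (R : realType) (n : nat) (a b : 'rV[R]_n) : set 'rV[R]_n :=
  [set x | forall i, a 0 i < x 0 i <= b 0 i].

Definition box_volume (R : realType) (n : nat) (a b : 'rV[R]_n) : R :=
  \prod_(i < n) (b 0 i - a 0 i).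

Definition lebesgue_outer (R : realType) (n : nat) (A : set 'rV[R]_n) : \bar R :=
  ereal_inf [set s | exists a b : nat -> 'rV[R]_n,
    [/\ forall k i, a k 0 i <= b k 0 i,
        A `<=` \bigcup_k box (a k) (b k)
      & s = (\sum_(0 <= k <oo) (box_volume (a k) (b k))%:E)%E]].

(* On compact sets of reals this is the Hausdorff metric; the empty set is at
   distance +oo from every nonempty set. *)
Definition thickening (R : realType) (e : R) (A : set R) : set R :=
  [set x | exists2 a, A a & `|x - a| <= e].

Definition hausdorff_dist (R : realType) (A B : set R) : \bar R :=
  ereal_inf [set e%:E | e in [set e : R |
    [/\ 0 <= e, A `<=` thickening e B & B `<=` thickening e A]]].

(* Homeomorphism between the subspaces [A] and [B] of the real line; [f] and
   [g] are only relevant on [A] and [B], respectively. *)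
Definition homeomorphic (R : realType) (A B : set R) : Prop :=
  exists f g : R -> R,
    [/\ {homo f : x / A x >-> B x} /\ {homo g : y / B y >-> A y},
        {within A, continuous f}, {within B, continuous g},
        (forall x, A x -> g (f x) = x) & (forall y, B y -> f (g y) = y)].

Definition unitI (R : realType) : set R := `[0, 1[%classic.
Arguments unitI R : clear implicits.

(* A parameter vector is (gamma_1, ..., gamma_r, beta_1, ..., beta_(r-1)).
   Translations are indexed from 0: [gamma p i] is gamma_(i+1), acting on
   the interval [beta p i, beta p i.+1[ , with beta p 0 = 0, beta p r = 1. *)
Definition gamma (R : realType) (r : nat) (p : 'rV[R]_(r + r.-1)) (i : 'I_r) : R :=
  lsubmx p 0 i.

Definition beta (R : realType) (r : nat) (p : 'rV[R]_(r + r.-1)) (k : nat) : R :=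
  if k is k'.+1 then
    if insub k' : option 'I_r.-1 is Some j then rsubmx p 0 j else 1
  else 0.

Definition ITM (R : realType) (r : nat) : set 'rV[R]_(r + r.-1) :=
  [set p | forall i : 'I_r,
     beta p i < beta p i.+1 /\ - beta p i <= gamma p i <= 1 - beta p i.+1].
Arguments ITM R r : clear implicits.

(* Only the values on [unitI R] are relevant. *)
Definition itm (R : realType) (r : nat) (p : 'rV[R]_(r + r.-1)) (x : R) : R :=
  if [pick i : 'I_r | beta p i <= x < beta p i.+1] is Some i
  then x + gamma p i else x.

Definition itm_image (R : realType) (r : nat) (p : 'rV[R]_(r + r.-1)) (n : nat) :
  set R := iter n (itm p) @` unitI R.

Definition attractor (R : realType) (r : nat) (p : 'rV[R]_(r + r.-1)) : set R :=
  \bigcap_n itm_image p n.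

Definition finite_type (R : realType) (r : nat) : set 'rV[R]_(r + r.-1) :=
  [set p | ITM R r p /\ exists n, itm_image p n.+1 = itm_image p n].
Arguments finite_type R r : clear implicits.

Definition infinite_type (R : realType) (r : nat) : set 'rV[R]_(r + r.-1) :=
  ITM R r `\` finite_type R r.
Arguments infinite_type R r : clear implicits.

(* The number of indices 1 <= k <= r - 1 with beta_k outside the closure of
   the attractor; for p in ITM(r) the beta_k are pairwise distinct. *)
Definition nb_disc_outside (R : realType) (r : nat) (p : 'rV[R]_(r + r.-1)) : nat :=
  #|[set j : 'I_r.-1 |
      `[< (unitI R `\` closure (attractor p)) (beta p j.+1) >]]%SET|.

Definition stable (R : realType) (r : nat) : set 'rV[R]_(r + r.-1) :=
  [set p | ITM R r p /\ exists U : set 'rV[R]_(r + r.-1),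
    [/\ U `<=` ITM R r, within (ITM R r) (nbhs p) U,
        (forall q, U q ->
           hausdorff_dist (closure (attractor q')) (closure (attractor q))
             @[q' --> within U (nbhs q)] --> 0%E),
        (forall q, U q ->
           homeomorphic (closure (attractor q)) (closure (attractor p)))
      & (forall q, U q -> nb_disc_outside q = nb_disc_outside p)]].
Arguments stable R r : clear implicits.

(* Main.v *)
Require Import Defs.
From mathcomp Require Import all_boot all_order all_algebra.
From mathcomp Require Import all_classical all_reals all_analysis.
From mathcomp Require Import ring lra.

Import Order.TTheory GRing.Theory Num.Theory.
Import numFieldNormedType.Exports.

Set Implicit Arguments.
Unset Strict Implicit.
Unset Printing Implicit Defensive.

Local Open Scope classical_set_scope.
Local Open Scope ring_scope.

(** Call a parameter vector p generic when distinct affine forms with integer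
coefficients take distinct values at p.  The vectors that are not generic lie
on countably many hyperplanes, a null set ([null_nongeneric]), so it suffices
that a generic map of finite type is stable ([generic_finite_type_stable]).

Let p be generic and of finite type, T^(n+1)(I) = T^n(I).  All the sets T^k(I)
with k <= n + 1 are cut out of the line by finitely many points, obtained from
0, 1 and the beta_j by adding sums of the gamma_i: the values at p of a finite
list F of integer affine forms ([knots]).  Since these values are pairwise
distinct, they come in the same order at every q close to p.  For such q let
h_q be the increasing piecewise linear homeomorphism of the line that sends
the value of f at p to the value of f at q, for each f in F ([interp]).

The map h_q need not conjugate the two interval translation mappings, but it
respects the images: T_q^k(I) = h_q(T^k(I)) for k <= n + 1
([itm_image_transport]).  Indeed, whether a point belongs to T^k(I), and which
translation is then applied to it, depends only on the position of the point
among the cut points; and translating by gamma_i corresponds to adding the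
form gamma_i, an operation that h_q respects on the forms in F.  Hence T_q
also stabilises at step n, and the attractor of T_q is h_q applied to the
attractor of T.  So the closures are homeomorphic, the beta_j outside the
closure are the same for p and q because h_q sends beta_j(p) to beta_j(q), and
continuity in the Hausdorff metric follows from the fact that h_q depends
continuously on q, uniformly on [0,1] ([interp_dist]). *)

(** * Null sets in R^n *)

Definition null (R : realType) (n : nat) (A : set 'rV[R]_n) : Prop :=
  forall e : R, 0 < e -> exists a b : nat -> 'rV[R]_n,
    [/\ forall k i, a k 0 i <= b k 0 i,
        A `<=` \bigcup_k box (a k) (b k)
      & (\esum_(k in [set: nat]) (box_volume (a k) (b k))%:E <= e%:E)%E].

Lemma box_volume_ge0 (R : realType) (n : nat) (a b : 'rV[R]_n) :
  (forall i, a 0 i <= b 0 i) -> 0 <= box_volume a b.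
Proof. by move=> ab; apply: prodr_ge0 => i _; rewrite subr_ge0. Qed.

Lemma null_outer (R : realType) (n : nat) (A : set 'rV[R]_n) :
  null A -> lebesgue_outer A = 0%E.
Proof.
move=> nA; apply/eqP; rewrite eq_le; apply/andP; split.
  apply/lee_addgt0Pr => e e0; rewrite add0e.
  have [a [b [ab cov le_e]]] := nA _ e0.
  apply: le_trans le_e; apply: ereal_inf_lbound; exists a, b; split => //.
  by rewrite nneseries_esumT // => k; rewrite lee_fin box_volume_ge0.
apply: le_ereal_inf_tmp => _ [a [b [ab _ ->]]].
by apply: nneseries_ge0 => k _ _; rewrite lee_fin box_volume_ge0.
Qed.

Lemma null_sub (R : realType) (n : nat) (A B : set 'rV[R]_n) :
  A `<=` B -> null B -> null A.
Proof.
move=> AB nB e /nB[a [b [ab cov le_e]]].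
by exists a, b; split => //; apply: subset_trans cov.
Qed.

(** Lets weights chosen on [nat], such as e / 2^(k+1), be used on any countable
index type. *)
Lemma esum_pickle (R : realType) (J : countType) (f : nat -> \bar R) :
  (forall k, 0 <= f k)%E ->
  (\esum_(j in [set: J]) f (pickle j) <= \esum_(k in [set: nat]) f k)%E.
Proof.
move=> f0; rewrite -(esum_image [set: J] pickle f); last first.
  by move=> x y _ _; exact: (pcan_inj pickleK).
rewrite [X in (X <= _)%E]esum_mkcond; apply: le_esum => k _.
by case: ifP.
Qed.

(** The index type is turned into [nat] by padding with the empty box between 0
and 0.  Its volume is 0 because the dimension is positive: in dimension 0 the
volume, an empty product, would be 1. *)
Lemma null_countable_cover (R : realType) (n : nat) (A : set 'rV[R]_n.+1) :
  (forall e : R, 0 < e -> exists (J : countType) (a b : J -> 'rV[R]_n.+1),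
    [/\ forall j i, a j 0 i <= b j 0 i,
        A `<=` \bigcup_j box (a j) (b j)
      & (\esum_(j in [set: J]) (box_volume (a j) (b j))%:E <= e%:E)%E]) ->
  null A.
Proof.
move=> cA e /cA[J [a [b [ab cov le_e]]]].
pose pad (c : J -> 'rV[R]_n.+1) k := oapp c 0 (pickle_inv k).
exists (pad a), (pad b); split.
- by move=> k i; rewrite /pad; case: pickle_inv => //=.
- move=> x /cov[j _ jx]; exists (pickle j) => //.
  by rewrite /pad pickleK_inv.
apply: le_trans le_e.
rewrite [leRHS](_ : _ = \esum_(j in [set: J])
   (box_volume (pad a (pickle j)) (pad b (pickle j)))%:E)%E; last first.
  by apply: eq_esum => j _; rewrite /pad pickleK_inv.
rewrite -(esum_image [set: J] pickle
  (fun k => (box_volume (pad a k) (pad b k))%:E)); last first.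
  by move=> x y _ _; exact: (pcan_inj pickleK).
rewrite [leRHS]esum_mkcond; apply: le_esum => k _.
case: ifP => // /negbT; rewrite notin_setE => nk.
rewrite /pad; case E : (pickle_inv k) => [j|/=].
  by exfalso; apply: nk; exists j => //; have := @pickle_invK J k; rewrite E.
by rewrite /box_volume big_ord_recl subrr mul0r.
Qed.

Lemma null_bigcup (R : realType) (n : nat) (J : countType)
    (A : J -> set 'rV[R]_n.+1) :
  (forall j, null (A j)) -> null (\bigcup_j A j).
Proof.
move=> nA; apply: null_countable_cover => e e0.
have eps0 (j : J) : 0 < e / (2 ^ (pickle j).+1)%:R.
  by rewrite divr_gt0 // ltr0n expn_gt0.
have /choice[f fP] : forall j : J,
    exists f : (nat -> 'rV[R]_n.+1) * (nat -> 'rV[R]_n.+1),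
    [/\ forall k i, f.1 k 0 i <= f.2 k 0 i,
        A j `<=` \bigcup_k box (f.1 k) (f.2 k)
      & (\esum_(k in [set: nat]) (box_volume (f.1 k) (f.2 k))%:E
          <= (e / (2 ^ (pickle j).+1)%:R)%:E)%E].
  by move=> j; have [a [b H]] := nA j _ (eps0 j); exists (a, b).
exists (J * nat)%type, (fun u => (f u.1).1 u.2), (fun u => (f u.1).2 u.2); split.
- by move=> [j k] i; have [H _ _] := fP j; exact: H.
- move=> x [j _ jx]; have [_ H _] := fP j; have [k _ kx] := H _ jx.
  by exists (j, k).
have -> : [set: J * nat] = [set: J] `*`` (fun=> [set: nat]).
  by apply/seteqP; split => // -[].
rewrite -(esum_esum (a := fun j k => (box_volume ((f j).1 k) ((f j).2 k))%:E));
  last first.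
  by move=> j k _ _; rewrite lee_fin box_volume_ge0 // => i; have [H _ _] := fP j.
apply: (@le_trans _ _ (\esum_(j in [set: J]) (e / (2 ^ (pickle j).+1)%:R)%:E)%E).
  by apply: le_esum => j _; have [_ _ H] := fP j.
have ge0 k : (0 <= (e / (2 ^ k.+1)%:R)%:E)%E.
  by rewrite lee_fin divr_ge0 // ltW.
apply: le_trans (esum_pickle _ ge0) _.
rewrite -nneseries_esumT //; apply: epsilon_trick0; exact: ltW.
Qed.

Lemma esum_cst_fin (R : realType) (T : finType) (v : R) :
  0 <= v -> (\esum_(t in [set: T]) v%:E)%E = (v *+ #|T|)%:E.
Proof.
move=> v0; have -> : [set: T] = [set` index_enum T].
  by apply/seteqP; split => // t _ /=; rewrite mem_index_enum.
rewrite esum_fset; [|exact: finite_seq|by move=> t _; rewrite lee_fin].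
by rewrite -fsbig_seq ?index_enum_uniq // sumEFin sumr_const cardT.
Qed.

Lemma grid_cell (R : realType) (K : nat) (t : R) :
  0 < t <= K%:R -> exists g : 'I_K, g%:R < t <= g.+1%:R.
Proof.
move=> /andP[t0 tK].
have K0 : (0 < K)%N by rewrite -(ltr0n R) (lt_le_trans t0).
have ex : exists k, t <= k.+1%:R by exists K.-1; rewrite prednK.
case: (ex_minnP ex) => m tm mmin.
have mK : (m < K)%N by rewrite -(prednK K0) ltnS mmin // prednK.
exists (Ordinal mK); rewrite tm andbT /=.
case: m {mK} tm mmin => [//|m] tm mmin.
by rewrite ltNge; apply/negP => /mmin; rewrite ltnn.
Qed.

(** Over each cell, of side d, of a grid on the other coordinates, the graph
stays within a multiple of d of its value at the corner of the cell.  So the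
part of the graph in a fixed cube is covered by boxes of total volume of the
order of d. *)
Lemma null_affine_graph (R : realType) (n : nat) (i0 : 'I_n.+1) (c : 'I_n -> R)
    (c0 : R) :
  null [set x : 'rV[R]_n.+1 | x 0 i0 = c0 + \sum_j c j * x 0 (lift i0 j)].
Proof.
pose G := [set x : 'rV[R]_n.+1 | x 0 i0 = c0 + \sum_j c j * x 0 (lift i0 j)].
pose Q M := [set x : 'rV[R]_n.+1 | forall i, `|x 0 i| < M%:R].
suff nGQ : forall M, null (G `&` Q M.+1).
  apply: null_sub (null_bigcup nGQ) => x Gx.
  exists (Num.truncn (\sum_i `|x 0 i|)) => //; split=> // i.
  apply: le_lt_trans (truncnS_gt _).
  by rewrite (bigD1 i) //= lerDl sumr_ge0.
move=> M; apply: null_countable_cover => e e0.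
(* C * d bounds the oscillation on a cell; the summand 1 makes it strict. *)
pose C := 1 + \sum_j `|c j|.
have C0 : 0 < C by rewrite ltr_pwDl // sumr_ge0.
pose W : R := 2 * M.+1%:R.
have W0 : 0 < W by rewrite mulr_gt0 // ltr0n.
pose K := (Num.truncn (2 * C * W ^+ n.+1 / e)).+1.
have KP : 2 * C * W ^+ n.+1 / e < K%:R by exact: truncnS_gt.
have K0 : 0 < K%:R :> R by rewrite ltr0n.
pose d : R := W / K%:R.
have d0 : 0 < d by rewrite divr_gt0.
pose low (g : {ffun 'I_n -> 'I_K}) j : R := - M.+1%:R + (g j)%:R * d.
pose mid g := c0 + \sum_j c j * low g j.
exists ({ffun 'I_n -> 'I_K} : finType).
exists (fun g => \row_i if unlift i0 i is Some j then low g j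
                        else mid g - C * d).
exists (fun g => \row_i if unlift i0 i is Some j then low g j + d
                        else mid g + C * d).
split.
- move=> g i; rewrite !mxE; case: unliftP => [j _|_].
    by rewrite lerDl ltW.
  by rewrite lerD2l ge0_cp // mulr_ge0 // ltW.
- move=> x [Gx Qx].
  have /choice[g gP] : forall j, exists g : 'I_K,
      g%:R < (x 0 (lift i0 j) + M.+1%:R) / d <= g.+1%:R.
    move=> j; apply: grid_cell.
    have /ltr_normlP[H1 H2] := Qx (lift i0 j).
    rewrite divr_gt0 //=; last by lra.
    rewrite ler_pdivrMr // /d mulrC divfK ?gt_eqF // /W; lra.
  exists [ffun j => g j] => // i; rewrite !mxE.
  have lowP j : low [ffun j => g j] j < x 0 (lift i0 j)
                <= low [ffun j => g j] j + d.
    have := gP j; rewrite ltr_pdivlMr // ler_pdivrMr // /low ffunE.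
    rewrite -[(g j).+1%:R]natr1 mulrDl mul1r => /andP[? ?].
    by apply/andP; split; lra.
  case: unliftP => [j ->|->]; first exact: lowP.
  rewrite Gx.
  suff : `|\sum_j c j * x 0 (lift i0 j) - \sum_j c j * low [ffun j => g j] j|
         < C * d.
    by rewrite ltr_distl /mid => /andP[? ?]; apply/andP; split; lra.
  rewrite -sumrB mulrDl mul1r.
  apply: (@le_lt_trans _ _ ((\sum_j `|c j|) * d)); last by lra.
  rewrite mulr_suml; apply: le_trans (ler_norm_sum _ _ _) _.
  apply: ler_sum => j _; rewrite -mulrBr normrM ler_wpM2l //.
  have := lowP j => /andP[? ?]; rewrite ger0_norm; lra.
pose v := 2 * C * d * d ^+ n.
apply: (@le_trans _ _ (\esum_(g in [set: {ffun 'I_n -> 'I_K} : finType]) v%:E)%E).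
  apply: le_esum => g _; rewrite lee_fin /box_volume (bigD1_ord i0) //=.
  rewrite !mxE unlift_none (eq_bigr (fun=> d)); last first.
    by move=> j _; rewrite !mxE liftK addrC addKr.
  rewrite prodr_const card_ord /v.
  by have -> : 2 * C * d = mid g + C * d - (mid g - C * d) by lra.
rewrite esum_cst_fin; last by rewrite !mulr_ge0 ?exprn_ge0 // ltW.
rewrite lee_fin card_ffun !card_ord -mulr_natr natrX.
have -> : v * K%:R ^+ n = 2 * C * W ^+ n.+1 / K%:R.
  have dK : d * K%:R = W by rewrite divfK // gt_eqF.
  by rewrite /v -[in LHS]mulrA -exprMn dK exprS /d; ring.
by rewrite ler_pdivrMr // [e * _]mulrC ltW // -ltr_pdivrMr.
Qed.

(** * Integer affine forms and generic parameters *)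

(** The pair (c, m) stands for the affine form x |-> sum_j c_j x_j + m.  A pair
type makes the forms a countable additive group. *)
Notation aform n := ('rV[int]_n * int)%type.

Definition ev (R : realType) (n : nat) (q : 'rV[R]_n) (f : aform n) : R :=
  \sum_j (f.1 0 j)%:~R * q 0 j + f.2%:~R.

Definition generic (R : realType) (n : nat) (p : 'rV[R]_n) : Prop :=
  injective (ev p).

Lemma evD (R : realType) (n : nat) (q : 'rV[R]_n) (f g : aform n) :
  ev q (f + g) = ev q f + ev q g.
Proof.
rewrite /ev /= rmorphD /= addrACA -big_split /=; congr (_ + _).
by apply: eq_bigr => j _; rewrite !mxE rmorphD mulrDl.
Qed.

Lemma ev_coord (R : realType) (n : nat) (q : 'rV[R]_n) (j : 'I_n) :
  ev q (delta_mx 0 j, 0) = q 0 j.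
Proof.
rewrite /ev addr0 (bigD1 j) //= mxE !eqxx mul1r big1 ?addr0 // => k kj.
by rewrite mxE (negPf kj) andbF mul0r.
Qed.

Lemma ev_const (R : realType) (n : nat) (q : 'rV[R]_n) (m : int) :
  ev q (0, m) = m%:~R.
Proof. by rewrite /ev big1 ?add0r // => j _; rewrite mxE mul0r. Qed.

Lemma ev_continuous (R : realType) (n : nat) (f : aform n) :
  continuous (fun q : 'rV[R]_n => ev q f).
Proof.
move=> q; rewrite /ev.
apply: (@cvgD _ _ _ (nbhs q) _ (fun q : 'rV[R]_n => \sum_j (f.1 0 j)%:~R * q 0 j)
  (fun=> f.2%:~R)); last exact: cvg_cst.
apply: cvg_big => [|j _]; first exact: add_continuous.
apply: (@cvgM _ _ (nbhs q) _ (fun=> (f.1 0 j)%:~R) (fun q : 'rV[R]_n => q 0 j)).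
  exact: cvg_cst.
exact: coord_continuous.
Qed.

(** If the linear parts of f and g agree, their values differ everywhere;
otherwise one coordinate is an affine function of the others. *)
Lemma null_coincidence (R : realType) (n : nat) (f g : aform n.+1) :
  f != g -> null [set p : 'rV[R]_n.+1 | ev p f = ev p g].
Proof.
move=> fg; have [e1|ne1] := eqVneq f.1 g.1.
  apply: null_sub (null_affine_graph (R := R) ord0 (fun=> 0) 0) => p /= evfg.
  case/negP: fg; apply/eqP; rewrite [f]surjective_pairing [g]surjective_pairing.
  congr pair => //; apply/eqP; rewrite -(eqr_int R); apply/eqP.
  by move: evfg; rewrite /ev e1 => /addrI.
have /rV0Pn[i0] : f.1 - g.1 != 0 by rewrite subr_eq0.
rewrite !mxE => ne.
pose D i : R := (f.1 0 i - g.1 0 i)%:~R.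
have D0 : D i0 != 0 by rewrite /D intr_eq0.
apply: null_sub (null_affine_graph i0 (fun j => - D (lift i0 j) / D i0)
  ((g.2 - f.2)%:~R / D i0)) => p /= evfg.
have : \sum_j D j * p 0 j = (g.2 - f.2)%:~R.
  move: evfg; rewrite /ev => evfg.
  rewrite (eq_bigr (fun j => (f.1 0 j)%:~R * p 0 j - (g.1 0 j)%:~R * p 0 j)).
    by rewrite sumrB rmorphB /=; lra.
  by move=> j _; rewrite /D rmorphB mulrBl.
rewrite (bigD1_ord i0) //= => eq0.
apply: (mulfI D0).
have -> : D i0 * p 0 i0 = (g.2 - f.2)%:~R
    - \sum_(j < n) D (lift i0 j) * p 0 (lift i0 j) by rewrite -eq0; ring.
rewrite mulrDr [D i0 * (_ / _)]mulrC divfK // -sumrN mulr_sumr.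
congr (_ + _); apply: eq_bigr => j _; clearbody D.
by field.
Qed.

Lemma null_nongeneric (R : realType) (n : nat) :
  null [set p : 'rV[R]_n.+1 | ~ generic p].
Proof.
pose J : countType := {u : aform n.+1 * aform n.+1 | u.1 != u.2}.
have nA (j : J) : null [set p : 'rV[R]_n.+1 | ev p (val j).1 = ev p (val j).2].
  by apply: null_coincidence; exact: (valP j).
apply: null_sub (null_bigcup nA) => p ngp.
apply: contrapT => np; apply: ngp => f g fg.
apply/eqP; apply: contra_notT np => ne.
by exists (exist (fun u => u.1 != u.2) (f, g) ne).
Qed.

(** * Piecewise linear homeomorphisms of the line *)

(** Piecewise linear interpolation through the points (a w, e w) for w in
u :: s, extended to the right with slope 1 and to the left by the first linear
piece.  Indexing both coordinates by w makes the inverse of [interp a e u s] be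
[interp e a u s]. *)
Fixpoint interp (R : realType) (T : Type) (a e : T -> R) (u : T) (s : seq T)
    (x : R) : R :=
  if s is v :: s' then
    if x <= a v then e u + (x - a u) * ((e v - e u) / (a v - a u))
    else interp a e v s' x
  else x - a u + e u.

Definition increasing_along (R : realType) (T : Type) (a : T -> R) (u : T)
    (s : seq T) :=
  path (fun f g => a f < a g) u s.

Lemma increasing_along_lt (R : realType) (T : eqType) (a : T -> R) (u : T)
    (s : seq T) (w : T) :
  increasing_along a u s -> w \in s -> a u < a w.
Proof.
move=> /order_path_min/allP H ws; apply: (H _ w ws).
by move=> y x z; apply: lt_trans.
Qed.

Lemma interp_knot (R : realType) (T : eqType) (a e : T -> R) (u : T)
    (s : seq T) (w : T) :
  increasing_along a u s -> w \in u :: s -> interp a e u s (a w) = e w.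
Proof.
elim: s u => [|v s IH] u /=; first by rewrite inE => _ /eqP ->; ring.
move=> /andP[uv vs]; rewrite inE => /orP[/eqP ->|wvs].
  by rewrite ltW // subrr mul0r addr0.
have [->|wv] := eqVneq w v.
  by rewrite lexx; field; rewrite subr_eq0 gt_eqF.
have ws : w \in s by move: wvs; rewrite inE (negPf wv).
by rewrite leNgt (increasing_along_lt vs ws) /= IH.
Qed.

Lemma interp_lt (R : realType) (T : eqType) (a e : T -> R) (u : T) (s : seq T) :
  increasing_along a u s -> increasing_along e u s ->
  {homo interp a e u s : x y / x < y}.
Proof.
elim: s u => [|v s IH] u /=; first by move=> _ _ x y xy; lra.
move=> /andP[auv avs] /andP[euv evs] x y xy.
have sl : 0 < (e v - e u) / (a v - a u) by rewrite divr_gt0 // subr_gt0.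
case: (leP y (a v)) => [yv|vy].
  by rewrite (ltW (lt_le_trans xy yv)) ltrD2l ltr_pM2r // ltrD2r.
have kv : interp a e v s (a v) = e v by rewrite interp_knot ?mem_head.
case: (leP x (a v)) => [xv|vx]; last exact: IH.
apply: (@le_lt_trans _ _ (interp a e v s (a v))); last exact: IH.
rewrite kv -lerBrDl mulrC -ler_pdivlMl // invf_div.
have -> : (a v - a u) / (e v - e u) * (e v - e u) = a v - a u.
  by rewrite divfK // subr_eq0 gt_eqF.
by rewrite lerD2r.
Qed.

Lemma interpK (R : realType) (T : eqType) (a e : T -> R) (u : T) (s : seq T) :
  increasing_along a u s -> increasing_along e u s ->
  cancel (interp a e u s) (interp e a u s).
Proof.
elim: s u => [|v s IH] u; first by move=> _ _ x /=; ring.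
move=> aI eI x; have mono := le_mono (interp_lt aI eI).
have : (interp a e u (v :: s) x <= e v) = (x <= a v).
  by rewrite -(mono x) (interp_knot e aI) // !inE eqxx orbT.
rewrite /= => ->; move: aI eI => /= /andP[auv avs] /andP[euv evs].
have [xv|vx] := leP x (a v); last exact: IH.
by field; rewrite !subr_eq0 !gt_eqF.
Qed.

(** Between two knots the difference of the interpolants is a convex combination
of the differences at the knots, and to the right of the last knot it is
constant.  The linear extension to the left would spoil the bound, hence the
assumption a u <= x. *)
Lemma interp_dist (R : realType) (T : eqType) (a e e' : T -> R) (u : T) (s : seq T)
    (eps : R) (x : R) :
  increasing_along a u s -> a u <= x ->
  (forall w, w \in u :: s -> `|e w - e' w| <= eps) ->
  `|interp a e u s x - interp a e' u s x| <= eps.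
Proof.
elim: s u => [|v s IH] u /= aI ux le_eps.
  by rewrite opprD addrACA subrr add0r le_eps // mem_head.
move: aI => /andP[auv avs]; case: (leP x (a v)) => [xv|vx]; last first.
  by apply: IH => //; [exact: ltW|move=> w ws; rewrite le_eps // inE ws orbT].
pose t := (x - a u) / (a v - a u).
have t0 : 0 <= t by rewrite divr_ge0 // subr_ge0 // ltW.
have t1 : t <= 1 by rewrite ler_pdivrMr ?subr_gt0 // mul1r lerD2r.
have -> : e u + (x - a u) * ((e v - e u) / (a v - a u))
    - (e' u + (x - a u) * ((e' v - e' u) / (a v - a u)))
    = (1 - t) * (e u - e' u) + t * (e v - e' v).
  by rewrite /t; field; rewrite subr_eq0 gt_eqF.
clearbody t; apply: le_trans (ler_normD _ _) _.
have Hu : `|e u - e' u| <= eps by rewrite le_eps ?mem_head.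
have Hv : `|e v - e' v| <= eps by rewrite le_eps // !inE eqxx orbT.
rewrite !normrM (ger0_norm t0) ger0_norm ?subr_ge0 //.
have -> : eps = (1 - t) * eps + t * eps by ring.
by apply: lerD; apply: ler_wpM2l; rewrite ?subr_ge0.
Qed.

Definition order_iso (R : realType) (h g : R -> R) : Prop :=
  [/\ {mono h : x y / x <= y}, cancel h g & cancel g h].

Lemma order_iso_sym (R : realType) (h g : R -> R) : order_iso h g -> order_iso g h.
Proof. by move=> [hm hg gh]; split => // x y; rewrite -hm !gh. Qed.

(** The preimage of an open interval is an open interval. *)
Lemma order_iso_continuous (R : realType) (h g : R -> R) :
  order_iso h g -> continuous h.
Proof.
move=> [hm hg gh] x; have hlt := leW_mono hm.
apply/cvgrPdist_lt => e e0.
have lo : g (h x - e) < x by rewrite -hlt gh; lra.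
have hi : x < g (h x + e) by rewrite -hlt gh; lra.
near=> y.
have H1 : g (h x - e) < y by near: y; exact: lt_nbhsr.
have H2 : y < g (h x + e) by near: y; exact: lt_nbhsl.
move: H1; rewrite -hlt gh => H1; move: H2; rewrite -hlt gh => H2.
by rewrite ltr_distl; apply/andP; split; lra.
Unshelve. all: by end_near. Qed.

Lemma order_iso_closure (R : realType) (h g : R -> R) (A : set R) :
  order_iso h g -> closure (h @` A) = h @` closure A.
Proof.
suff sub : forall (h' g' : R -> R) B, order_iso h' g' ->
    h' @` closure B `<=` closure (h' @` B).
  move=> hg; apply/seteqP; split; last exact: sub hg.
  have [_ hK gK] := hg; move=> y cy; exists (g y); last exact: gK.
  rewrite [X in closure X](_ : A = g @` (h @` A)); last first.
    by rewrite image_comp; under eq_imagel do rewrite /= hK; rewrite image_id.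
  by apply: sub (order_iso_sym hg) _ _; exists y.
move=> h' g' A' hg _ [x cx <-] B hB.
have [z [Bz Az]] := cx _ (order_iso_continuous hg hB).
by exists (h' z); split => //; exists z.
Qed.

(** * Images of the unit interval under an interval translation mapping *)

Definition gamma_form (r : nat) (i : 'I_r) : aform (r + r.-1) :=
  (delta_mx 0 (lshift _ i), 0).

Definition beta_form (r k : nat) : aform (r + r.-1) :=
  if k is k'.+1 then
    if insub k' : option 'I_r.-1 is Some j then (delta_mx 0 (rshift r j), 0)
    else (0, 1)
  else (0, 0).

Lemma ev_gamma_form (R : realType) (r : nat) (q : 'rV[R]_(r + r.-1)) (i : 'I_r) :
  ev q (gamma_form i) = gamma q i.
Proof. by rewrite ev_coord /gamma mxE. Qed.

Lemma ev_beta_form (R : realType) (r : nat) (q : 'rV[R]_(r + r.-1)) (k : nat) :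
  ev q (beta_form r k) = beta q k.
Proof.
case: k => [|k]; first exact: ev_const.
rewrite /beta_form /beta; case: insubP => [j _ _|_]; last exact: ev_const.
by rewrite ev_coord mxE.
Qed.

Lemma beta_last (R : realType) (r : nat) (q : 'rV[R]_(r + r.-1)) :
  (0 < r)%N -> beta q r = 1.
Proof. by case: r q => // r q _; rewrite /beta insubN //= ltnn. Qed.

(** [knots r k] cuts out the k-th image of the unit interval.  Keeping the old
forms at each step ensures that the discontinuities are always among the cut
points. *)
Fixpoint knots (r k : nat) : seq (aform (r + r.-1)) :=
  if k is k'.+1 then
    knots r k' ++ [seq f + gamma_form i | f <- knots r k', i <- enum 'I_r]
  else [seq beta_form r j | j <- iota 0 r.+1].

Lemma beta_form_knots (r j k : nat) : (j <= r)%N -> beta_form r j \in knots r k.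
Proof.
move=> jr; elim: k => [|k IH]; last by rewrite /= mem_cat IH.
by apply: (map_f (beta_form r)); rewrite mem_iota.
Qed.

Lemma knotsS (r k : nat) : {subset knots r k <= knots r k.+1}.
Proof. by move=> f fk; rewrite /= mem_cat fk. Qed.

Lemma knots_translate (r k : nat) (i : 'I_r) (f : aform (r + r.-1)) :
  f \in knots r k -> f + gamma_form i \in knots r k.+1.
Proof.
move=> fk; rewrite /= mem_cat; apply/orP; right; apply/allpairsP.
by exists (f, i); rewrite mem_enum.
Qed.

Definition cut_equiv (R : realType) (n : nat) (p : 'rV[R]_n)
    (F : seq (aform n)) (x y : R) :=
  forall f, f \in F -> (ev p f <= x) = (ev p f <= y).

(** The unions of cells of the partition of the line into half-open intervals by
the points ev p f.  Put this way, no list of intervals has to be carried through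
intersections, translations and unions. *)
Definition cut_by (R : realType) (n : nat) (p : 'rV[R]_n)
    (F : seq (aform n)) (S : set R) :=
  forall x y, cut_equiv p F x y -> S x -> S y.

Definition branch (R : realType) (r : nat) (p : 'rV[R]_(r + r.-1)) (x : R) :=
  [pick i : 'I_r | beta p i <= x < beta p i.+1].

Lemma itm_branch (R : realType) (r : nat) (p : 'rV[R]_(r + r.-1)) (x : R) :
  itm p x = x + oapp (gamma p) 0 (branch p x).
Proof. by rewrite /itm /branch; case: pickP => //= _; rewrite addr0. Qed.

Lemma eq_branch (R : realType) (r k : nat) (p q : 'rV[R]_(r + r.-1)) (x y : R) :
  (forall f, f \in knots r k -> (ev p f <= x) = (ev q f <= y)) ->
  branch p x = branch q y.
Proof.
move=> xy; apply: eq_pick => i.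
rewrite !ltNge -!ev_beta_form !xy //; apply: beta_form_knots => //.
exact: ltnW.
Qed.

Definition transports (R : realType) (n : nat) (p q : 'rV[R]_n)
    (F : seq (aform n)) (h : R -> R) :=
  forall f, f \in F -> h (ev p f) = ev q f.

(** Points without a branch are fixed; they count here as translated by the zero
form. *)
Lemma branch_form (R : realType) (r k : nat) (o : option 'I_r) :
  exists c, [/\ forall q : 'rV[R]_(r + r.-1), ev q c = oapp (gamma q) 0 o
    & forall f, f \in knots r k -> f + c \in knots r k.+1].
Proof.
case: o => [i|]; [exists (gamma_form i)|exists 0]; split=> [q|f fk] /=.
- exact: ev_gamma_form.
- exact: knots_translate.
- exact: ev_const.
- by rewrite addr0; exact: knotsS.
Qed.

(** Translating back by the form c of the branch turns the cut points f + c of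
the image into the cut points f of S. *)
Lemma cut_by_itm (R : realType) (r k : nat) (p : 'rV[R]_(r + r.-1)) (S : set R) :
  cut_by p (knots r k) S -> cut_by p (knots r k.+1) (itm p @` S).
Proof.
move=> cS z y + [x Sx xz]; rewrite -{}xz itm_branch.
have [c [evc kc]] := branch_form R k (branch p x).
rewrite -evc => xy.
have xy' : cut_equiv p (knots r k) x (y - ev p c).
  move=> f fk; rewrite lerBrDr -evD -xy; last exact: kc.
  by rewrite evD lerD2r.
exists (y - ev p c); first exact: cS xy' Sx.
by rewrite itm_branch -(eq_branch xy') -evc subrK.
Qed.

(** The points h (itm p x) and itm q (h x) may differ, but they lie in the same
cell: both compare with the cut points f + c as x does with the cut points f.
As S is a union of cells, the images of S agree as sets. *)
Lemma itm_transport (R : realType) (r k : nat) (p q : 'rV[R]_(r + r.-1)) (h g : R -> R)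
    (S : set R) :
  order_iso h g -> transports p q (knots r k.+1) h ->
  cut_by p (knots r k) S ->
  itm q @` (h @` S) = h @` (itm p @` S).
Proof.
move=> [hm hg gh] tr cS.
have trS f : f \in knots r k -> h (ev p f) = ev q f.
  by move=> fk; apply: tr; exact: knotsS.
have hbranch x : branch p x = branch q (h x).
  by apply: (@eq_branch _ _ k) => f fk; rewrite -trS // hm.
apply/seteqP; split => [_ [_ [x Sx <-] <-]|_ [_ [x Sx <-] <-]].
  have [c [evc kc]] := branch_form R k (branch p x).
  pose y := g (h x + ev q c).
  have xy : cut_equiv p (knots r k) x (y - ev p c).
    move=> f fk; rewrite lerBrDr -evD -[RHS]hm gh tr; last exact: kc.
    by rewrite evD lerD2r -trS // hm.
  exists y.
    exists (y - ev p c); first exact: cS xy Sx.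
    by rewrite itm_branch -(eq_branch xy) -evc subrK.
  by rewrite gh itm_branch -hbranch -evc.
have [c [evc kc]] := branch_form R k (branch p x).
pose y := g (h (x + ev p c) - ev q c).
have xy : cut_equiv p (knots r k) x y.
  move=> f fk; rewrite -[RHS]hm gh lerBrDr trS // -evD -tr; last exact: kc.
  by rewrite hm evD lerD2r.
exists (h y); first by exists y => //; exact: cS xy Sx.
by rewrite itm_branch -hbranch -(eq_branch xy) -evc gh subrK itm_branch -evc.
Qed.

Lemma itm_image0 (R : realType) (r : nat) (p : 'rV[R]_(r + r.-1)) :
  itm_image p 0 = unitI R.
Proof. by rewrite -[RHS]image_id. Qed.

Lemma itm_imageS (R : realType) (r : nat) (p : 'rV[R]_(r + r.-1)) (k : nat) :
  itm_image p k.+1 = itm p @` itm_image p k.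
Proof. by rewrite /itm_image image_comp. Qed.

Lemma unitI_cut_by (R : realType) (r : nat) (p : 'rV[R]_(r + r.-1)) :
  (0 < r)%N -> cut_by p (knots r 0) (unitI R).
Proof.
move=> r0 x y xy; rewrite /unitI /= !in_itv /= => /andP[x0 x1].
have e0 := ev_beta_form p 0; have e1 := ev_beta_form p r.
have b1 := beta_last p r0.
move: (xy _ (beta_form_knots 0 (leq0n r))) (xy _ (beta_form_knots 0 (leqnn r))).
rewrite e0 e1 b1 x0 (leNgt 1 x) x1 => <- /esym/negbT.
by rewrite -ltNge.
Qed.

Lemma itm_image_cut_by (R : realType) (r : nat) (p : 'rV[R]_(r + r.-1)) (k : nat) :
  (0 < r)%N -> cut_by p (knots r k) (itm_image p k).
Proof.
move=> r0; elim: k => [|k IH]; last by rewrite itm_imageS; exact: cut_by_itm.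
by rewrite itm_image0; exact: unitI_cut_by.
Qed.

Lemma itm_image_transport (R : realType) (r k : nat) (p q : 'rV[R]_(r + r.-1))
    (h g : R -> R) :
  (0 < r)%N -> order_iso h g -> transports p q (knots r k) h ->
  itm_image q k = h @` itm_image p k.
Proof.
move=> r0 hg; elim: k => [|k IH] tr; last first.
  rewrite !itm_imageS IH; last by move=> f fk; apply: tr; exact: knotsS.
  by apply: itm_transport hg tr _; exact: itm_image_cut_by.
have h0 : h 0 = 0.
  by have := tr _ (beta_form_knots 0 (leq0n r)); rewrite !ev_beta_form.
have h1 : h 1 = 1.
  by have := tr _ (beta_form_knots 0 (leqnn r)); rewrite !ev_beta_form !beta_last.
have [hm hK gK] := hg; have hlt := leW_mono hm.
rewrite !itm_image0 /unitI; apply/seteqP; split => [y /=|_ [x x01 <-] /=].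
  rewrite in_itv /= => /andP[y0 y1]; exists (g y); last exact: gK.
  by rewrite /= in_itv /= -hm -hlt gK h0 h1 y0.
rewrite in_itv /=; move: x01; rewrite /= in_itv /= => /andP[x0 x1].
by rewrite -[X in X <= _]h0 -[X in _ < X]h1 hm hlt x0.
Qed.

Lemma itm_unitI (R : realType) (r : nat) (p : 'rV[R]_(r + r.-1)) (x : R) :
  ITM R r p -> unitI R x -> unitI R (itm p x).
Proof.
move=> Tp; rewrite /unitI /= !in_itv /= => /andP[x0 x1]; rewrite /itm.
case: pickP => [i /andP[bx xb]|_]; last by rewrite x0.
by have [_ /andP[? ?]] := Tp i; apply/andP; split; lra.
Qed.

Lemma itm_image_unitI (R : realType) (r : nat) (p : 'rV[R]_(r + r.-1)) (k : nat) :
  ITM R r p -> itm_image p k `<=` unitI R.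
Proof.
move=> Tp; elim: k => [|k IH]; first by rewrite itm_image0.
by rewrite itm_imageS => _ [x /IH Ix <-]; exact: itm_unitI.
Qed.

Lemma attractor_stationary (R : realType) (r : nat) (p : 'rV[R]_(r + r.-1))
    (k : nat) :
  ITM R r p -> itm_image p k.+1 = itm_image p k -> attractor p = itm_image p k.
Proof.
move=> Tp st.
have sub m : itm_image p m.+1 `<=` itm_image p m.
  elim: m => [|m IH]; last first.
    rewrite !(itm_imageS _ m.+1) [in X in _ `<=` X]itm_imageS.
    exact: image_subset.
  by rewrite itm_imageS itm_image0 => _ [x Ix <-]; exact: itm_unitI.
have up m : itm_image p (k + m) = itm_image p k.
  by elim: m => [|m IH]; rewrite ?addn0 // addnS itm_imageS IH -itm_imageS.
have down m d : itm_image p (m + d) `<=` itm_image p m.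
  elim: d => [|d IH]; first by rewrite addn0.
  by rewrite addnS; apply: subset_trans IH.
apply/seteqP; split => [x|x kx m _]; first exact.
by apply: (down m k); rewrite addnC up.
Qed.

(** * Stability of generic maps of finite type *)

Definition same_order (R : realType) (n : nat) (F : seq (aform n))
    (p q : 'rV[R]_n) :=
  {in F &, forall f g, ev p f < ev p g -> ev q f < ev q g}.

(** Genericity makes the values at p of distinct forms distinct, so that sorting
F by value is strict. *)
Lemma generic_enum (R : realType) (n : nat) (p : 'rV[R]_n) (F : seq (aform n))
    (f0 : aform n) :
  generic p -> f0 \in F ->
  exists u s, increasing_along (ev p) u s /\ u :: s =i F.
Proof.
move=> gp f0F; pose L := sort (relpre (ev p) <=%O) (undup F).
have LF : L =i F by move=> f; rewrite mem_sort mem_undup.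
have : sorted (relpre (ev p) <%O) L.
  rewrite -sorted_map /L -sort_map sort_lt_sorted map_inj_uniq //.
  exact: undup_uniq.
case: L LF => [|u s] LF us; first by move: (LF f0); rewrite f0F.
by exists u, s.
Qed.

Lemma same_order_increasing (R : realType) (n : nat) (F : seq (aform n))
    (p q : 'rV[R]_n) (u : aform n) (s : seq (aform n)) :
  same_order F p q -> u :: s =i F ->
  increasing_along (ev p) u s -> increasing_along (ev q) u s.
Proof.
move=> pq usF; apply: (@sub_in_path _ (mem F)).
  by move=> f g fF gF; exact: pq.
by apply/allP => f; rewrite usF.
Qed.

Lemma near_seq (T : Type) (I : eqType) (G : set_system T) (s : seq I)
    (P : I -> set T) :
  Filter G -> (forall i, G (P i)) -> G [set x | forall i, i \in s -> P i x].
Proof.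
move=> FG GP; elim: s => [|i s IH]; first by apply: filterE => x.
apply: filterS (filterI (GP i) IH) => x [Pi Ps] j.
by rewrite inE => /orP[/eqP ->|/Ps].
Qed.

Lemma same_order_near (R : realType) (n : nat) (F : seq (aform n)) (p : 'rV[R]_n) :
  nbhs p (same_order F p).
Proof.
apply: filterS (_ : nbhs p [set q | forall f, f \in F -> forall g, g \in F ->
   ev p f < ev p g -> ev q f < ev q g]) => [q H f g fF gF|]; first exact: H.
apply: near_seq => f; apply: near_seq => g.
have [fg|fg] := boolP (ev p f < ev p g); last exact: filterE.
have cfg : ev q g - ev q f @[q --> p] --> ev p g - ev p f.
  have cf := @ev_continuous R n f p; have cg := @ev_continuous R n g p.
  exact: (cvgB cg cf).
have pos : 0 < ev p g - ev p f by rewrite subr_gt0.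
by apply: filterS (cvgr_gt _ cfg 0 pos) => q /=; rewrite subr_gt0.
Qed.

Lemma hausdorff_dist_images (R : realType) (h h' : R -> R) (C : set R) (eps : R) :
  0 <= eps -> (forall x, C x -> `|h x - h' x| <= eps) ->
  (hausdorff_dist (h @` C) (h' @` C) <= eps%:E)%E.
Proof.
move=> e0 hh'; apply: ereal_inf_lbound; exists eps => //; split=> //.
  by move=> _ [x Cx <-]; exists (h' x); [exists x|exact: hh'].
by move=> _ [x Cx <-]; exists (h x); [exists x|rewrite distrC; exact: hh'].
Qed.

Lemma hausdorff_dist_ge0 (R : realType) (A B : set R) :
  (0 <= hausdorff_dist A B)%E.
Proof. by apply: le_ereal_inf_tmp => _ [e [e0 _ _] <-]; rewrite lee_fin. Qed.

Lemma generic_finite_type_stable (R : realType) (r : nat) (p : 'rV[R]_(r + r.-1)) :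
  (0 < r)%N -> generic p -> finite_type R r p -> stable R r p.
Proof.
move=> r0 gp [Tp [n stp]].
pose F := knots r n.+1.
have F0 : beta_form r 0 \in F by exact: beta_form_knots.
have [u [s [us usF]]] := generic_enum gp F0.
pose U := ITM R r `&` same_order F p.
pose h q := interp (ev p) (ev q) u s.
pose g q := interp (ev q) (ev p) u s.
have inc q : U q -> increasing_along (ev q) u s.
  by move=> [_ pq]; exact: same_order_increasing pq usF us.
have iso q : U q -> order_iso (h q) (g q).
  move=> /inc uq; split; [|exact: interpK|exact: interpK].
  by apply: le_mono; exact: interp_lt.
have tr q : U q -> transports p q F (h q).
  by move=> Uq f; rewrite -usF; exact: interp_knot.
have hbeta q (j : nat) : U q -> (j <= r)%N -> h q (beta p j) = beta q j.
  by move=> Uq jr; rewrite -!ev_beta_form tr //; exact: beta_form_knots.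
have Xp := attractor_stationary Tp stp.
have Xq q : U q -> attractor q = h q @` attractor p.
  move=> Uq; have [Tq _] := Uq; have hg := iso q Uq; have trq := tr q Uq.
  have trn : transports p q (knots r n) (h q).
    by move=> f fn; apply: trq; exact: knotsS.
  have stq : itm_image q n.+1 = itm_image q n.
    by rewrite (itm_image_transport r0 hg trq) (itm_image_transport r0 hg trn) stp.
  by rewrite (attractor_stationary Tq stq) (itm_image_transport r0 hg trn) Xp.
pose C := closure (attractor p).
have Cq q : U q -> closure (attractor q) = h q @` C.
  by move=> Uq; rewrite Xq // (order_iso_closure _ (iso q Uq)).
have C_ge0 x : C x -> 0 <= x.
  have sub : attractor p `<=` [set x : R | 0 <= x].
    move=> y; rewrite Xp => /(itm_image_unitI Tp).
    by rewrite /unitI /= in_itv /= => /andP[].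
  have /closure_id cl : closed [set x : R | 0 <= x] by exact: closed_ge.
  by move=> /(closure_subset sub); rewrite -cl.
(* The first knot is at most 0, as 0 itself is a knot; so [interp_dist] applies
   on the closure of the attractor. *)
have u_le0 : ev p u <= 0.
  rewrite -[leRHS]/(beta p 0) -ev_beta_form.
  move: F0; rewrite -usF inE => /orP[/eqP <- //|F0].
  by rewrite ltW // (increasing_along_lt us).
split=> //; exists U; split.
- by move=> q [].
- rewrite /within /=; apply: filterS (same_order_near F p) => q pq Tq.
  by split.
- move=> q Uq.
  pose M q' := \sum_(f <- u :: s) `|ev q' f - ev q f|.
  apply: (@squeeze_cvge _ _ _ _ (fun=> 0%E) _ (fun q' => (M q')%:E)).
  + near=> q'; rewrite hausdorff_dist_ge0 /=.
    have Uq' : U q' by near: q'; exact: withinT.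
    rewrite !Cq //; apply: hausdorff_dist_images => [|x Cx].
      exact: sumr_ge0.
    apply: interp_dist => //; first exact: le_trans u_le0 (C_ge0 _ Cx).
    move=> f fus; rewrite /M (perm_big _ (perm_to_rem fus)) big_cons.
    by rewrite lerDl sumr_ge0.
  + exact: cvg_cst.
  + apply: cvg_EFin; first exact: nearW.
    have M0 : 0 = M q by rewrite /M big1 // => f _; rewrite subrr normr0.
    rewrite [X in _ --> X]M0; apply: cvg_within_filter.
    apply: cvg_big => [|f _]; first exact: add_continuous.
    have cf := @ev_continuous R _ f q.
    exact: cvg_norm (cvgB cf (cvg_cst (ev q f))).
- move=> q Uq; have hg := iso q Uq; have [_ hK gK] := hg; rewrite Cq // -/C.
  exists (g q), (h q); split.
  + by split=> [_ [x Cx <-]|x Cx]; [rewrite hK|exists x].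
  + by apply: continuous_subspaceT; exact: order_iso_continuous (order_iso_sym hg).
  + by apply: continuous_subspaceT; exact: order_iso_continuous hg.
  + by move=> x _; exact: gK.
  + by move=> x _; exact: hK.
- move=> q Uq; have hg := iso q Uq; have [hm hK gK] := hg; have hlt := leW_mono hm.
  rewrite /nb_disc_outside; apply: eq_card => j; rewrite !inE.
  apply: asbool_equiv_eq; rewrite Cq // -/C.
  have jr : (j.+1 <= r)%N by exact: leq_trans (ltn_ord j) (leq_pred r).
  have h0 : h q 0 = 0 by exact: (hbeta q 0%N Uq (leq0n r)).
  have h1 : h q 1 = 1 by rewrite -(beta_last p r0) hbeta // !beta_last.
  have eqI : unitI R (beta q j.+1) = unitI R (beta p j.+1).
    rewrite -(hbeta q j.+1) //; move: (beta p _) => b.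
    rewrite /unitI /= !in_itv /= -[in LHS]h0 -[in LHS]h1.
    by rewrite hm hlt.
  have eqC : (h q @` C) (beta q j.+1) = C (beta p j.+1).
    rewrite -(hbeta q j.+1) //; apply/propext.
    split=> [[x Cx /(can_inj hK) <-] //|Cj].
    by exists (beta p j.+1).
  by split=> -[Ij nC]; split; rewrite ?eqI ?eqC // -?eqI -?eqC.
Unshelve. all: by end_near. Qed.

Unset Implicit Arguments.

Theorem theorem7p1 (R : realType) (r : nat) (hr : (2 <= r)%N) :
  lebesgue_outer ((ITM R r `\` stable R r) `\` infinite_type R r) = 0%E.
Proof.
apply: null_outer.
have sub : (ITM R r `\` stable R r) `\` infinite_type R r `<=` [set p | ~ generic p].
  move=> p [[Tp nSp] nIp] gp; apply: nSp.
  apply: generic_finite_type_stable => //; first exact: ltnW.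
  by apply: contrapT => nFp; apply: nIp.
apply: null_sub sub _.
case: r hr => [|[|r]] // _; exact: (@null_nongeneric R (r.+1 + r.+1)).
Qed.
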